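(* Let $Y$ be one of the graphs $\mathbb{G}^{Q,q}$ ($q\ge 2$, $q<Q\le Q(q)$) or $\mathbb{H}^Q$ ($3\le Q\le 7$), with perturbed subset $S$, root $0\in S$, balls $\Lambda_n$, $S_n=S\cap\Lambda_n$, and let $v$ be the Perron--Frobenius eigenvector of $A_Y$ given explicitly in the context. Then $$\lim_{n}\frac{\big\|v\lceil_{\ell^2(\Lambda_n)}\big\|^2\,|S_n|}{|\Lambda_n|}=0 .$$
   Context: Graphs. $\mathbb{G}^Q$ is the homogeneous Cayley tree in which every vertex has degree $Q$ ($\mathbb{G}^2=\mathbb{Z}$), $d$ is its graph distance, $A_{\mathbb{G}^Q}$ its adjacency operator on $\ell^2(\mathbb{G}^Q)$, with norm $2\sqrt{Q-1}$. Given a subtree $S\subset\mathbb{G}^Q$ and a root $0\in S$, the perturbed graph $Y$ has the same vertices and an additional self-loop at each vertex of $S$, so $A_Y=A_{\mathbb{G}^Q}+P_{\ell^2(S)}$, where $P_{\ell^2(S)}$ is the orthogonal projection onto $\ell^2(S)$. Then $Y=\mathbb{G}^{Q,q}$ when $S$ is isomorphic to $\mathbb{G}^q$, with $q\ge2$ and $q<Q\le Q(q)$, where $Q(q)=\big[\big(2\sqrt{q-1}+1+\sqrt{4\sqrt{q-1}+1}\big)^2/4\big]+1$ ($[\cdot]$ = integer part); and $Y=\mathbb{H}^Q$ when $S$ is a half-line isomorphic to $\mathbb{N}$ with end vertex $0$, $3\le Q\le7$. In all these cases $\|A_Y\|>2\sqrt{Q-1}$. Exhaustion: $\Lambda_n$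 is the ball of radius $n$ centred at $0$ (in the tree metric $d$), $|\Lambda_n|$ its number of vertices, $S_n=S\cap\Lambda_n$. Perron--Frobenius eigenvector: for $\lambda>2\sqrt{Q-1}$ put $a(\lambda)=\dfrac{1-\sqrt{1-4(Q-1)/\lambda^2}}{2(Q-1)/\lambda}$. For a vertex $x$ let $y(x)\in S$ be the unique vertex with $d(x,S)=d(x,y(x))$. Then $v(x)=a(\|A_Y\|)^{d(x,S)}\,w(y(x))$, where on $S$: $w(x)=\big(1-a(\|A_{\mathbb{H}^Q}\|)\big)d(x,0)+1$ if $Y=\mathbb{H}^Q$, and $w(x)=\big(1+\frac{q-2}{q}d(x,0)\big)(q-1)^{-d(x,0)/2}$ if $Y=\mathbb{G}^{Q,q}$. The vector $v$ has positive entries, satisfies $\sum_y (A_Y)_{xy}v(y)=\|A_Y\|v(x)$ for all $x$, and $v(0)=1$. *)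

(* Defs.v *)
From mathcomp Require Import all_boot all_order all_algebra.
From mathcomp Require Import finmap complex.
From mathcomp Require Import all_classical all_reals all_analysis.

Set Implicit Arguments.
Unset Strict Implicit.
Unset Printing Implicit Defensive.

Import Order.TTheory GRing.Theory Num.Theory.
Import numFieldNormedType.Exports.

Local Open Scope classical_set_scope.
Local Open Scope card_scope.
Local Open Scope complex_scope.
Local Open Scope ring_scope.

Section Graphs.
Variables (V : choiceType) (e : rel V).

Definition walk (x y : V) : set (seq V) :=
  [set p | path e x p /\ last x p = y].

Definition connected_graph : Prop := forall x y, exists p, walk x y p.

(* A simple closed path in the sense of [cycle] with one vertex (a loop) or
   two vertices (an edge run back and forth) is not a graph-theoretic cycle. *)
Definition acyclic_graph : Prop :=
  forall c : seq V, cycle e c -> uniq c -> (size c <= 2)%N.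

Definition homogeneous_tree (Q : nat) : Prop :=
  [/\ symmetric e, irreflexive e, connected_graph, acyclic_graph
    & forall x, [set y | e x y] #= `I_Q].

(* The value is 0 if [P] is empty. *)
Definition min_nat (P : set nat) : nat :=
  xget 0%N [set n | P n /\ forall m, P m -> (n <= m)%N].

Definition dist (x y : V) : nat := min_nat [set size p | p in walk x y].

Definition dist_set (x : V) (S : set V) : nat := min_nat [set dist x y | y in S].

(* The fallback [o] is never used for a nonempty [S]. *)
Definition nearest (S : set V) (o x : V) : V :=
  xget o [set y | S y /\ dist x y = dist_set x S].

Definition tree_ball (o : V) (n : nat) : set V := [set x | (dist x o <= n)%N].

End Graphs.

(* [f] is an isomorphism of the graph [eW] onto the subgraph of [e] induced by
   [S]; inside a tree, a subtree is always an induced subgraph. *)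
Definition iso_onto (W V : choiceType) (eW : rel W) (e : rel V) (f : W -> V)
    (S : set V) : Prop :=
  [/\ injective f, range f = S & forall x y, e (f x) (f y) = eW x y].

Definition half_line : rel nat := [rel i j | (i.+1 == j) || (j.+1 == i)].

Definition card_set (V : choiceType) (A : set V) : nat := #|` fset_set A|.

Section Operators.
Variables (R : realType) (V : choiceType).
Implicit Types f : V -> R[i].

Definition l2_sum f : \bar R :=
  (\esum_(x in setT) (Normc.normc (f x) ^+ 2)%:E)%E.

Definition l2 : set (V -> R[i]) := [set f | (l2_sum f < +oo)%E].

(* Meaningful for [f] in [l2] only. *)
Definition l2norm f : R := Num.sqrt (fine (l2_sum f)).

Definition opnorm (A : (V -> R[i]) -> (V -> R[i])) : R :=
  sup [set l2norm (A f) | f in [set f | l2 f /\ l2norm f <= 1]].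

Definition adjacency (e : rel V) f : V -> R[i] :=
  fun x => \sum_(y \in [set y | e x y]) f y.

Definition l2_proj (S : set V) f : V -> R[i] :=
  fun x => if x \in S then f x else 0.

Definition perturbed_adjacency (e : rel V) (S : set V) f : V -> R[i] :=
  fun x => adjacency e f x + l2_proj S f x.

Definition normAY (e : rel V) (S : set V) : R :=
  opnorm (perturbed_adjacency e S).

End Operators.

Section PerronFrobenius.
Variable R : realType.

Definition a_fun (Q : nat) (lambda : R) : R :=
  (1 - Num.sqrt (1 - 4 * (Q%:R - 1) / lambda ^+ 2))
  / (2 * (Q%:R - 1) / lambda).

Definition Qmax (q : nat) : nat :=
  (Num.truncn ((2 * Num.sqrt (q%:R - 1) + 1
                + Num.sqrt (4 * Num.sqrt (q%:R - 1) + 1)) ^+ 2 / 4 : R)).+1.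

Variables (V : choiceType) (e : rel V) (Q : nat) (S : set V) (o : V).

Definition w_H (x : V) : R :=
  (1 - a_fun Q (normAY R e S)) * (dist e x o)%:R + 1.

Definition w_G (q : nat) (x : V) : R :=
  (1 + (q%:R - 2) / q%:R * (dist e x o)%:R)
  * (q%:R - 1) `^ (- ((dist e x o)%:R / 2)).

Definition pf_vector (w : V -> R) (x : V) : R :=
  a_fun Q (normAY R e S) ^+ dist_set e x S * w (nearest e S o x).

Definition restricted_norm (v : V -> R) (A : set V) : R :=
  l2norm (l2_proj A (fun x => (v x)%:C)).

Definition density_ratio (v : V -> R) (n : nat) : R :=
  restricted_norm v (tree_ball e o n) ^+ 2
  * (card_set (S `&` tree_ball e o n))%:R
  / (card_set (tree_ball e o n))%:R.

End PerronFrobenius.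

(* Main.v *)
Require Import Defs.
From mathcomp Require Import all_boot all_order all_algebra.
From mathcomp Require Import finmap complex zify lra ring.
From mathcomp Require Import all_classical all_reals all_analysis.

Set Implicit Arguments.
Unset Strict Implicit.
Unset Printing Implicit Defensive.

Import Order.TTheory GRing.Theory Num.Theory.
Import numFieldNormedType.Exports.

Local Open Scope classical_set_scope.
Local Open Scope ring_scope.

(* Whatever the value of [normAY], a := a_fun Q (normAY R e S) satisfies
   a >= 0 and a^2 (Q-1) <= 1.  The vertices x with nearest point y in S and
   d(x,S) = j number at most 2 (Q-1)^j, so each value of j contributes at most
   2 w(y)^2 to the squared norm.  Put r = q - 1, or r = 1 for the half-line.
   At most 2 r^k points y of S are at distance k from the root, and
   w(y)^2 <= (k+1)^2 r^(-k) for each of them.  The squared norm is thus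
   polynomial in n, |S_n| <= 2 (n+1) r^n and |Lambda_n| >= (Q-1)^n, so the ratio
   is O(n^5 (r/(Q-1))^n), with r < Q-1. *)

(** * The path metric of a connected graph *)

Lemma min_natP (P : set nat) :
  P !=set0 -> P (min_nat P) /\ forall m, P m -> (min_nat P <= m)%N.
Proof.
move=> [n0 Pn0].
have exP : exists n, (fun n => `[< P n >]) n by exists n0; apply/asboolP.
have [n /asboolP Pn minn] := ex_minnP exP.
suff : [set n | P n /\ forall m, P m -> (n <= m)%N] (min_nat P) by [].
apply: xgetPex; exists n; split=> // m Pm.
by apply: minn; apply/asboolP.
Qed.

Section ConnectedGraph.
Variables (V : choiceType) (e : rel V).
Hypotheses (esym : symmetric e) (econ : connected_graph e).

Lemma distP x y : exists2 p, walk e x y p & size p = dist e x y.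
Proof.
have [|[p ? ?] _] := @min_natP [set size p | p in walk e x y]; last by exists p.
by have [p wp] := econ x y; exists (size p), p.
Qed.

Lemma dist_le x y p : walk e x y p -> (dist e x y <= size p)%N.
Proof.
move=> wp; have [|_] := @min_natP [set size p | p in walk e x y].
  by exists (size p), p.
by apply; exists p.
Qed.

Lemma distxx x : dist e x x = 0%N.
Proof. by have := @dist_le x x [::]; rewrite leqn0 => /(_ _)/eqP; apply. Qed.

Lemma dist_eq0 x y : dist e x y = 0%N -> x = y.
Proof. by have [p [_ <-]] := distP x y => <- /size0nil ->. Qed.

Lemma dist_triangle y x z : (dist e x z <= dist e x y + dist e y z)%N.
Proof.
have [p [xp lp] <-] := distP x y; have [q [yq lq] <-] := distP y z.
rewrite -size_cat; apply: dist_le; split; last by rewrite last_cat lp.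
by rewrite cat_path xp lp.
Qed.

Lemma dist_sym x y : dist e x y = dist e y x.
Proof.
suff H a b : (dist e a b <= dist e b a)%N by apply/eqP; rewrite eqn_leq !H.
have [p [bp lp] <-] := distP b a.
rewrite -(size_belast b p) -size_rev; apply: dist_le; split.
  by rewrite -lp rev_path (eq_path (e' := e)).
by rewrite -lp; case: p {bp lp} => //= c p; rewrite rev_cons last_rcons.
Qed.

Lemma dist_edge x y z : e x y -> (dist e x z <= (dist e y z).+1)%N.
Proof.
move=> xy; apply: leq_trans (dist_triangle y x z) _.
rewrite -add1n leq_add2r; apply: (@dist_le x y [:: y]).
by split=> //=; rewrite xy.
Qed.

(** The second vertex of a shortest walk: the rest of the walk gives [<= k], and [dist_edge] the
    converse. *)
Lemma dist_parent x z k : dist e x z = k.+1 -> exists2 y, e x y & dist e y z = k.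
Proof.
move=> xz; have [[|y p] [/=]] := distP x z; rewrite xz => // /andP[xy yp] lp [sp].
exists y => //; apply/eqP; rewrite eqn_leq -{1}sp dist_le //=.
by rewrite -ltnS -xz dist_edge.
Qed.

Lemma dist_setP (S : set V) x :
  S !=set0 -> exists2 y, S y & dist e x y = dist_set e x S.
Proof.
move=> [y0 Sy0].
have [|[y ? ?] _] := @min_natP [set dist e x y | y in S]; last by exists y.
by exists (dist e x y0), y0.
Qed.

Lemma dist_set_le (S : set V) x y : S y -> (dist_set e x S <= dist e x y)%N.
Proof.
move=> Sy; have [|_] := @min_natP [set dist e x y | y in S].
  by exists (dist e x y), y.
by apply; exists y.
Qed.

Lemma nearestP (S : set V) o x :
  S !=set0 -> S (nearest e S o x) /\ dist e x (nearest e S o x) = dist_set e x S.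
Proof.
move=> S0; have [y Sy xy] := dist_setP x S0.
suff : [set y | S y /\ dist e x y = dist_set e x S] (nearest e S o x) by [].
by apply: xgetPex; exists y.
Qed.

End ConnectedGraph.

(** * Geodesics and subtrees in a tree *)

Section Tree.
Variables (V : choiceType) (e : rel V).
Hypotheses (esym : symmetric e) (eirr : irreflexive e).
Hypotheses (econ : connected_graph e) (eac : acyclic_graph e).

(** Closing a shortened such walk with the edge gives a simple cycle, so acyclicity leaves it at
    most one step: no step would give a loop, and one step would be the removed edge itself. *)
Lemma edge_bridge u v p : e u v ->
  path [rel x y | e x y && ((x, y) \notin [:: (u, v); (v, u)])] u p ->
  last u p <> v.
Proof.
move=> uv; case/shortenP=> p' pp' up' _ lp'.
have up : path e u p' by apply: sub_path pp' => x y /= /andP[].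
have := eac (c := u :: p').
rewrite [cycle _ _]/= rcons_path up lp' esym uv => /(_ isT up') /=.
case: p' pp' up' lp' {up} => [|a [|//]] /=.
  by move=> _ _ uE; rewrite uE eirr in uv.
by move=> /andP[/andP[_ +] _] _ av; rewrite av !inE eqxx.
Qed.

(* Otherwise removing the edge uv would keep u and v joined through o. *)
Lemma unique_parent o u v x : e u v -> (dist e u o <= dist e v o)%N ->
  e x v -> (dist e x o < dist e v o)%N -> u = x.
Proof.
move=> uv luv xv lxv; apply/eqP; apply: contraT => uNx.
pose e' := [rel x y | e x y && ((x, y) \notin [:: (u, v); (v, u)])].
have e'sym : symmetric e'.
  move=> a b; rewrite /= esym !inE !xpair_eqE orbC.
  by congr (_ && ~~ (_ || _)); exact: andbC.
(* Distances to [o] strictly decrease along a geodesic, so one that starts elsewhere than [v], no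
   further out than [v], never meets [v] and avoids the edge. *)
have to_o k z : dist e z o = k -> z != v -> (k <= dist e v o)%N ->
    exists2 p, path e' z p & last z p = o.
  elim: k z => [|k IH] z lz zv kv; first by exists [::] => //=; exact: dist_eq0 lz.
  have [y zy ly] := dist_parent econ lz.
  have yv : y != v by apply: contraTneq kv => <-; rewrite ly ltnn.
  have [p yp lp] := IH y ly yv (ltnW kv).
  exists (y :: p) => //=; rewrite yp zy /= andbT !inE !xpair_eqE.
  by rewrite (negPf zv) (negPf yv) andbF.
have vNu : u != v by apply: contraTneq uv => ->; rewrite eirr.
have vNx : x != v by apply: contraTneq xv => ->; rewrite eirr.
have [p up lp] := to_o _ u erefl vNu luv.
have [q xq lq] := to_o _ x erefl vNx (ltnW lxv).
(* Go from [u] to [o], back along the reverse of [q] to [x], then across to [v]; this last edge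
   differs from [uv] because [x] is not [u]. *)
exfalso; apply: (@edge_bridge u v (p ++ rcons (rev (belast x q)) v) uv).
  rewrite cat_path up lp /= rcons_path.
  have -> /= : path e' o (rev (belast x q)).
    by rewrite -lq rev_path (eq_path (e' := e')).
  have -> : last o (rev (belast x q)) = x.
    by rewrite -lq; case: (q) => //= c q'; rewrite rev_cons last_rcons.
  by rewrite /= xv /= !inE !xpair_eqE !(eq_sym x) (negPf uNx) (eq_sym v) (negPf vNx).
by rewrite last_cat last_rcons.
Qed.

(* The distance to [w0] in [eW] enters only through an abstract level function,
   so that on the half-line [lev] can be the identity. *)
Lemma dist_iso_onto (W : choiceType) (eW : rel W) (f : W -> V) (S : set V)
    (lev : W -> nat) (w0 : W) :
  iso_onto eW e f S -> (forall x, lev x = 0%N -> x = w0) -> lev w0 = 0%N ->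
  (forall x k, lev x = k.+1 -> exists2 y, eW x y & lev y = k) ->
  forall x, dist e (f x) (f w0) = lev x.
Proof.
move=> [finj _ fe] lev_eq0 lev0 lev_parent x.
move: {2}(lev x) (erefl (lev x)) => k; elim/ltn_ind: k x => -[|k] IH x lx.
  by rewrite (lev_eq0 _ lx) distxx.
have [y xy ly] := lev_parent _ _ lx.
have ey : e (f x) (f y) by rewrite fe.
have dy : dist e (f y) (f w0) = k by rewrite (IH k).
(* If [f x] were no further out than [f y], then either [f y] is at level 0 and [f x] is the root,
   or [f x] and the parent [f z] of [f y] coincide by [unique_parent], although [x] and [z] have
   different levels. *)
rewrite lx; apply/eqP; rewrite eqn_leq -{1}dy dist_edge //= ltnNge; apply/negP => lefx.
case: k => [|k] in IH lx ly dy lefx.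
  move: lefx; rewrite leqn0 => /eqP/(dist_eq0 econ)/finj xw.
  by move: lx; rewrite xw lev0.
have [z yz lz] := lev_parent _ _ ly.
have dz : dist e (f z) (f w0) = k by rewrite (IH k).
have : f x = f z.
  apply: (@unique_parent (f w0) _ (f y)) => //; first by rewrite dy.
    by rewrite esym fe.
  by rewrite dy dz.
by move=> /finj xz; move: lz; rewrite -xz lx => /eqP; rewrite eqn_leq ltnNge leqnSn.
Qed.

End Tree.

(** * Sphere sizes in a homogeneous tree *)

Definition sphere (V : choiceType) (e : rel V) (o : V) (k : nat) : set V :=
  [set x | dist e x o = k].

Section HomogeneousTree.
Variables (V : choiceType) (e : rel V) (Q : nat).
Hypothesis hV : homogeneous_tree e Q.

Let esym : symmetric e. Proof. by case: hV. Qed.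
Let eirr : irreflexive e. Proof. by case: hV. Qed.
Let econ : connected_graph e. Proof. by case: hV. Qed.
Let eac : acyclic_graph e. Proof. by case: hV. Qed.

Lemma finite_neighbors x : finite_set [set y | e x y].
Proof. by case: hV => _ _ _ _ /(_ x) xQ; exists Q. Qed.

Lemma card_neighbors x : #|` fset_set [set y | e x y]| = Q.
Proof. by case: hV => _ _ _ _ /(_ x)/card_fset_set. Qed.

Lemma sphere0 o : sphere e o 0 = [set o].
Proof.
apply/seteqP; split=> x; first exact: dist_eq0.
by move=> ->; exact: distxx.
Qed.

Lemma finite_sphere o k : finite_set (sphere e o k).
Proof.
elim: k => [|k IH]; first by rewrite sphere0; exact: finite_set1.
apply: (@sub_finite_set _ _ (\bigcup_(x in sphere e o k) [set y | e x y])).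
  by move=> y /(dist_parent econ)[x yx xk]; exists x => //=; rewrite esym.
by apply: bigcup_finite => // x _; exact: finite_neighbors.
Qed.

Lemma mem_sphere o k x : (x \in fset_set (sphere e o k)) = (dist e x o == k).
Proof.
rewrite in_fset_set; last exact: finite_sphere.
by apply/idP/eqP; rewrite inE.
Qed.

(** By [unique_parent], the only neighbour of [x] that is not one step further out is its parent;
    the root has none, whence the correction [k != 0]. *)
Lemma count_children o k x : dist e x o = k ->
  count (e x) (fset_set (sphere e o k.+1)) = (Q - (k != 0))%N.
Proof.
move=> xk.
have -> : count (e x) (fset_set (sphere e o k.+1)) =
    count [pred y | dist e y o == k.+1] (fset_set [set y | e x y]).
  rewrite -!size_filter; apply/perm_size/uniq_perm; rewrite ?filter_uniq ?fset_uniq //.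
  move=> y; rewrite !mem_filter mem_sphere in_fset_set; last exact: finite_neighbors.
  by rewrite mem_setE /= andbC.
apply/eqP; rewrite -(eqn_add2r (count (predC [pred y | dist e y o == k.+1])
  (fset_set [set y | e x y]))) count_predC -[size _]/(#|` _|) card_neighbors.
have sub1 y : y \in fset_set [set y | e x y] -> e x y.
  by rewrite in_fset_set ?inE //; exact: finite_neighbors.
have yk y : e x y -> (dist e y o <= k.+1)%N.
  by move=> xy; rewrite -xk dist_edge // esym.
case: k => [|k] in xk yk *.
  rewrite subn0 (@eq_in_count _ _ pred0) ?count_pred0 ?addn0 //.
  move=> y /sub1 xy /=; apply/negbF; rewrite eqn_leq yk //= lt0n.
  apply/eqP => /(dist_eq0 econ) yo; move: xy.
  by rewrite yo (dist_eq0 econ xk) eirr.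
have [p xp pk] := dist_parent econ xk.
rewrite (@eq_in_count _ _ (pred1 p)); last first.
  move=> y /sub1 xy /=; apply/idP/eqP => [yNk|->]; last by rewrite pk ltn_eqF.
  apply: (unique_parent esym eirr econ eac (o := o) (v := x)).
  - by rewrite esym.
  - by rewrite xk -ltnS ltn_neqAle yNk yk.
  - by rewrite esym.
  - by rewrite pk xk.
rewrite count_uniq_mem ?fset_uniq // in_fset_set; last exact: finite_neighbors.
have -> : p \in [set y | e x y] by rewrite inE.
(* The truncated subtraction [Q - 1] is genuine: [p] is a neighbour, so [Q] is positive. *)
rewrite subnK // -(card_neighbors x) -has_predT; apply/hasP; exists p => //.
by rewrite in_fset_set; [rewrite inE | exact: finite_neighbors].
Qed.

Lemma count_parents o k y : dist e y o = k.+1 ->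
  count (e^~ y) (fset_set (sphere e o k)) = 1%N.
Proof.
move=> yk; have [p yp pk] := dist_parent econ yk.
have py : e p y by rewrite esym.
rewrite (@eq_in_count _ _ (pred1 p)).
  by rewrite count_uniq_mem ?fset_uniq // mem_sphere pk eqxx.
move=> x; rewrite mem_sphere => /eqP xk /=; apply/idP/eqP => [xy|-> //].
by apply: (unique_parent esym eirr econ eac xy (o := o)); rewrite // yk ?xk ?pk.
Qed.

(** Double counting of the edges between consecutive spheres: each outer vertex has one parent. *)
Lemma card_sphereS o k :
  #|` fset_set (sphere e o k.+1)| =
  (#|` fset_set (sphere e o k)| * (Q - (k != 0)))%N.
Proof.
rewrite -!sum1_size big_distrl /=.
transitivity (\sum_(y <- fset_set (sphere e o k.+1))
    \sum_(x <- fset_set (sphere e o k)) (e x y : nat))%N.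
  apply: eq_big_seq => y; rewrite mem_sphere => /eqP yk.
  by rewrite -(count_parents yk) -sum1_count big_mkcond.
rewrite exchange_big; apply: eq_big_seq => x; rewrite mem_sphere => /eqP xk.
by rewrite mul1n -(count_children xk) -sum1_count [RHS]big_mkcond.
Qed.

Lemma card_sphere o k : #|` fset_set (sphere e o k.+1)| = (Q * (Q - 1) ^ k)%N.
Proof.
elim: k => [|k IH]; rewrite card_sphereS; last by rewrite IH expnSr mulnA.
by rewrite sphere0 fset_set1 cardfs1 mul1n subn0 muln1.
Qed.

(** The factor 2 absorbs the extra child of the root, since [Q <= 2 * (Q - 1)]. *)
Lemma card_sphere_le o k : (2 <= Q)%N ->
  (#|` fset_set (sphere e o k)| <= 2 * (Q - 1) ^ k)%N.
Proof.
case: k => [|k] Q2; first by rewrite sphere0 fset_set1 cardfs1.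
by rewrite card_sphere expnS mulnA leq_mul2r; apply/orP; right; lia.
Qed.

Lemma card_sphere_ge o k : ((Q - 1) ^ k <= #|` fset_set (sphere e o k)|)%N.
Proof.
case: k => [|k]; first by rewrite sphere0 fset_set1 cardfs1.
by rewrite card_sphere expnS leq_mul2r leq_subr orbT.
Qed.

End HomogeneousTree.

(** * Fiberwise estimates of finite sums *)

Lemma sumr_const_seq (M : nmodType) (T : Type) (s : seq T) (P : pred T) (c : M) :
  \sum_(x <- s | P x) c = c *+ count P s.
Proof. by rewrite big_const_seq iter_addr_0. Qed.

(** After exchanging the sums, each [x] contributes on the right at least its term [j = p x]; all
    other terms are nonnegative. *)
Lemma fiber_sum_le (R : realType) (T J : eqType) (s : seq T) (P : pred T)
    (t : seq J) (p : T -> J) (F : T -> R) :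
  (forall x, 0 <= F x) -> {in s, forall x, P x -> p x \in t} ->
  \sum_(x <- s | P x) F x <= \sum_(j <- t) \sum_(x <- s | P x && (p x == j)) F x.
Proof.
move=> F0 st; under [leRHS]eq_bigr => j _ do rewrite big_mkcond.
rewrite exchange_big /= [leLHS]big_mkcond big_seq [leRHS]big_seq.
apply: ler_sum => x xs; case: ifPn => Px /=; last by rewrite big1.
rewrite (big_rem (p x)) ?st //= eqxx lerDl.
by apply: sumr_ge0 => j _; case: ifP.
Qed.

Lemma ler_sum_count (R : realType) (T : eqType) (s : seq T) (P : pred T)
    (F : T -> R) (c : R) :
  {in s, forall x, P x -> F x <= c} ->
  \sum_(x <- s | P x) F x <= c * (count P s)%:R.
Proof.
move=> Fc; rewrite mulr_natr -sumr_const_seq.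
by rewrite big_seq_cond [leRHS]big_seq_cond; apply: ler_sum => x /andP[? ?]; exact: Fc.
Qed.

(** * The restricted norm, and bounds for the decay rate *)

Section RestrictedNorm.
Variables (R : realType) (V : choiceType).

Lemma restricted_norm_sq (v : V -> R) (A : set V) : finite_set A ->
  restricted_norm v A ^+ 2 = \sum_(x <- fset_set A) v x ^+ 2.
Proof.
move=> finA; rewrite /restricted_norm /l2norm.
have -> : l2_sum (l2_proj A (fun x => (v x)%:C%C)) =
    (\sum_(x <- fset_set A) v x ^+ 2)%:E.
  transitivity (\esum_(x in A) (v x ^+ 2)%:E)%E.
    rewrite [RHS]esum_mkcond; apply: eq_esum => x _; rewrite /l2_proj.
    by case: ifP => _ /=; rewrite expr0n /= addr0 ?expr0n ?sqrtr0 ?expr0n // sqr_sqrtr ?sqr_ge0.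
  rewrite esum_fset // => [|x _]; last by rewrite lee_fin sqr_ge0.
  by rewrite fsbig_finite // sumEFin.
by rewrite /= sqr_sqrtr // sumr_ge0 // => x _; exact: sqr_ge0.
Qed.

Lemma normAY_ge0 (e : rel V) (S : set V) : 0 <= normAY R e S.
Proof.
rewrite /normAY /opnorm; set B := [set _ | _ in _].
(* A set without a supremum has [sup] equal to 0 by convention. *)
have [supB|/sup_out ->] := pselect (has_sup B); last by rewrite lexx.
case: (supB) => -[x [f hf _]] ubB.
apply: le_trans (ub_le_sup ubB _); last by exists f.
exact: sqrtr_ge0.
Qed.

End RestrictedNorm.

(* For [lambda < 2 sqrt(Q-1)] the bounds hold through junk values:
   [Num.sqrt] of the negative discriminant is 0, and [a_fun Q 0 = 0]. *)
Lemma a_fun_bounds (R : realType) (Q : nat) (lambda : R) :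
  (2 <= Q)%N -> 0 <= lambda ->
  0 <= a_fun Q lambda /\ a_fun Q lambda ^+ 2 * (Q%:R - 1) <= 1.
Proof.
move=> Q2; rewrite /a_fun le_eqVlt => /predU1P[<-|l0].
  by rewrite !invr0 !mulr0 invr0 mulr0 expr0n /= mul0r.
have m0 : 0 < Q%:R - 1 :> R by rewrite subr_gt0 ltr1n.
set m := Q%:R - 1 in m0 *; set s := Num.sqrt _.
have s0 : 0 <= s by exact: sqrtr_ge0.
have l20 : 0 < lambda ^+ 2 by rewrite exprn_gt0.
have q0 : 0 <= 4 * m / lambda ^+ 2 by rewrite divr_ge0 ?mulr_ge0 // ltW.
have s1 : s <= 1 by rewrite -[leRHS]sqrtr1 ler_wsqrtr // gerBl.
split.
  by rewrite mulr_ge0 ?subr_ge0 // invr_ge0 divr_ge0 ?mulr_ge0 // ltW.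
have -> : ((1 - s) / (2 * m / lambda)) ^+ 2 * m = (1 - s) ^+ 2 * lambda ^+ 2 / (4 * m).
  by field; rewrite !gt_eqF.
rewrite ler_pdivrMr ?mul1r ?mulr_gt0 //.
have [d0|d0] := leP 0 (1 - 4 * m / lambda ^+ 2).
  (* Factoring [1 - s ^+ 2] reduces the claim to [1 - s <= 1 + s], up to nonnegative factors. *)
  have -> : 4 * m = (1 - s ^+ 2) * lambda ^+ 2.
    by rewrite sqr_sqrtr // opprB addrC subrK divfK ?gt_eqF.
  by rewrite ler_pM2r //; nra.
have -> : s = 0 by rewrite /s ler0_sqrtr // ltW.
by rewrite subr0 expr1n mul1r; move: d0; rewrite subr_lt0 ltr_pdivlMr // mul1r => /ltW.
Qed.

(** * An explicit upper bound for the density ratio *)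

Section DensityBound.
Variables (R : realType) (V : choiceType) (e : rel V) (Q : nat).
Hypotheses (hV : homogeneous_tree e Q) (Q2 : (2 <= Q)%N).
Variables (S : set V) (o : V).
Hypothesis So : S o.

Let esym : symmetric e. Proof. by case: hV. Qed.
Let econ : connected_graph e. Proof. by case: hV. Qed.
Let S0 : S !=set0. Proof. by exists o. Qed.

Lemma finite_ball n : finite_set (tree_ball e o n).
Proof.
apply: (@sub_finite_set _ _ (\bigcup_(k in `I_n.+1) sphere e o k)).
  by move=> x xn; exists (dist e x o).
by apply: bigcup_finite => // k _; exact: (finite_sphere hV).
Qed.

Lemma mem_ball n x : (x \in fset_set (tree_ball e o n)) = (dist e x o <= n)%N.
Proof.
rewrite in_fset_set; last exact: finite_ball.
by apply/idP/idP; rewrite inE.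
Qed.

Lemma finite_setI_ball n : finite_set (S `&` tree_ball e o n).
Proof. by apply: sub_finite_set (finite_ball n) => x []. Qed.

Lemma mem_setI_ball n x : x \in fset_set (S `&` tree_ball e o n) ->
  S x /\ (dist e x o <= n)%N.
Proof. by rewrite in_fset_set; [rewrite inE | exact: finite_setI_ball]. Qed.

Lemma card_ball_ge n : ((Q - 1) ^ n <= card_set (tree_ball e o n))%N.
Proof.
apply: leq_trans (card_sphere_ge hV o n) _; apply: fsubset_leq_card.
by apply/fsubsetP => x; rewrite (mem_sphere hV) mem_ball => /eqP ->.
Qed.

Variables (r : nat) (w : V -> R).
Hypotheses (r0 : (0 < r)%N) (rQ : (r < Q - 1)%N).
(** Both families of graphs enter through this growth bound and [w_decay]: [S] grows at most at the
    rate [r] at which the square of [w] decays. Duplicate-free sequences allow a direct application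
    to enumerated finite sets. *)
Hypothesis S_growth : forall (s : seq V) (k : nat), uniq s -> {in s, forall x, S x} ->
  (count (fun x => dist e x o == k) s <= 2 * r ^ k)%N.
Hypothesis w_decay : forall y, S y ->
  w y ^+ 2 * r%:R ^+ dist e y o <= (dist e y o).+1%:R ^+ 2.

Local Notation a := (a_fun Q (normAY R e S)).
Local Notation v := (pf_vector e Q S o w).

Lemma card_setI_ball_le n :
  (card_set (S `&` tree_ball e o n))%:R <= 2 * n.+1%:R * r%:R ^+ n :> R.
Proof.
rewrite /card_set -sum1_size natr_sum.
apply: (le_trans (fiber_sum_le (t := iota 0 n.+1) (p := fun x => dist e x o) _ _)) => //.
  by move=> x /mem_setI_ball[_ xn] _; rewrite mem_iota.
apply: (@le_trans _ _ (\sum_(k <- iota 0 n.+1) 2 * r%:R ^+ n)); last first.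
  by rewrite sumr_const_seq count_predT size_iota -[leLHS]mulr_natr mulrAC.
rewrite big_seq [leRHS]big_seq; apply: ler_sum => k; rewrite mem_iota add0n ltnS /= => kn.
apply: (le_trans (ler_sum_count (c := 1) _)) => //.
rewrite mul1r -natrX -natrM ler_nat; apply: (leq_trans (S_growth _ _ _)).
- exact: fset_uniq.
- by move=> x /mem_setI_ball[].
- by rewrite leq_mul2l leq_pexp2l.
Qed.

(** Growth and decay cancel on each sphere, so each of the [n.+1] distances contributes at most
    [2 * n.+1%:R ^+ 2]. *)
Lemma sum_w_le n : \sum_(y <- fset_set (S `&` tree_ball e o n)) w y ^+ 2
  <= 2 * n.+1%:R ^+ 3 :> R.
Proof.
apply: (le_trans (fiber_sum_le (t := iota 0 n.+1) (p := fun x => dist e x o) _ _)).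
- by move=> x; exact: sqr_ge0.
- by move=> x /mem_setI_ball[_ xn] _; rewrite mem_iota.
apply: (@le_trans _ _ (\sum_(k <- iota 0 n.+1) 2 * n.+1%:R ^+ 2)); last first.
  by rewrite sumr_const_seq count_predT size_iota -[leLHS]mulr_natr -mulrA -exprSr.
rewrite big_seq [leRHS]big_seq; apply: ler_sum => k; rewrite mem_iota add0n ltnS /= => kn.
have rk0 : 0 < r%:R ^+ k :> R by rewrite exprn_gt0 // ltr0n.
apply: (le_trans (ler_sum_count (c := n.+1%:R ^+ 2 / r%:R ^+ k) _)).
  move=> y /mem_setI_ball[Sy _] /= /eqP yk; rewrite ler_pdivlMr // -{1}yk.
  apply: (le_trans (w_decay Sy)); rewrite yk -!natrX ler_nat leq_exp2r //.
rewrite mulrAC ler_pdivrMr // [leRHS]mulrAC [leRHS]mulrC; apply: ler_wpM2l; first exact: sqr_ge0.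
rewrite -natrX -natrM ler_nat; apply: S_growth; first exact: fset_uniq.
by move=> x /mem_setI_ball[].
Qed.

(** Vertices over [y] at distance [j] from [S] lie on the sphere of radius [j] about [y]. Their
    number is compensated by the factor [a ^+ (2 * j)], because [a ^+ 2 * (Q%:R - 1) <= 1]. *)
Lemma sum_fiber_le y n :
  \sum_(x <- fset_set (tree_ball e o n) | nearest e S o x == y) v x ^+ 2
  <= 2 * n.+1%:R * w y ^+ 2.
Proof.
apply: (le_trans (fiber_sum_le (t := iota 0 n.+1) (p := fun x => dist_set e x S) _ _)).
- by move=> x; exact: sqr_ge0.
(* As [o] lies in [S], the distance to [S] is at most the distance to [o]. *)
- move=> x; rewrite mem_ball => xn _; rewrite mem_iota add0n ltnS /=.
  exact: leq_trans (dist_set_le e x So) xn.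
apply: (@le_trans _ _ (\sum_(j <- iota 0 n.+1) 2 * w y ^+ 2)); last first.
  by rewrite sumr_const_seq count_predT size_iota -[leLHS]mulr_natr mulrAC.
apply: ler_sum => j _.
apply: (le_trans (ler_sum_count (c := a ^+ (2 * j) * w y ^+ 2) _)).
  by move=> x _ /andP[/eqP xy /eqP xj]; rewrite /pf_vector xy xj exprMn -exprM mulnC.
rewrite mulrAC; apply: ler_wpM2r; first exact: sqr_ge0.
have cj : (count (fun x => (nearest e S o x == y) && (dist_set e x S == j))
    (fset_set (tree_ball e o n)) <= 2 * (Q - 1) ^ j)%N.
  apply: leq_trans (card_sphere_le hV y j Q2); rewrite -size_filter.
  apply: uniq_leq_size; first by rewrite filter_uniq // fset_uniq.
  move=> x; rewrite mem_filter (mem_sphere hV) => /andP[/andP[/eqP <- /eqP <-] _].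
  by have [_ ->] := nearestP e o x S0.
apply: (@le_trans _ _ (a ^+ (2 * j) * (2 * (Q - 1) ^ j)%:R)).
  by rewrite ler_wpM2l ?exprn_even_ge0 ?oddM // ler_nat.
have [_ aQ] := a_fun_bounds Q2 (normAY_ge0 R e S).
rewrite natrM natrX natrB ?(ltnW Q2) // mulrCA exprM -exprMn.
rewrite -[leRHS]mulr1 ler_wpM2l // exprn_ile1 // mulr_ge0 ?sqr_ge0 //.
by rewrite subr_ge0 ler1n ltnW.
Qed.

(* By the triangle inequality, [nearest x] is within 2n of [o] for x in the
   ball of radius n, which costs only a constant factor. *)
Lemma restricted_norm_le n :
  restricted_norm v (tree_ball e o n) ^+ 2 <= 4 * (2 * n).+1%:R ^+ 4.
Proof.
rewrite restricted_norm_sq; last exact: finite_ball.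
apply: (le_trans (fiber_sum_le (t := fset_set (S `&` tree_ball e o (2 * n)))
    (p := nearest e S o) _ _)) => [x|x|].
- exact: sqr_ge0.
- rewrite mem_ball => xn _; have [Sy xy] := nearestP e o x S0.
  rewrite in_fset_set; last exact: finite_setI_ball.
  rewrite inE; split=> //=; apply: leq_trans (dist_triangle econ x _ _) _.
  rewrite mul2n -addnn (dist_sym esym econ) xy.
  by apply: leq_add => //; exact: leq_trans (dist_set_le e x So) xn.
apply: (@le_trans _ _ (\sum_(y <- fset_set (S `&` tree_ball e o (2 * n)))
    2 * n.+1%:R * w y ^+ 2)).
  by apply: ler_sum => y _; exact: sum_fiber_le.
rewrite -mulr_sumr.
apply: (@le_trans _ _ (2 * (2 * n).+1%:R * (2 * (2 * n).+1%:R ^+ 3))).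
  apply: ler_pM; rewrite ?mulr_ge0 ?ler0n //.
  - by apply: sumr_ge0 => y _; exact: sqr_ge0.
  - by rewrite ler_pM2l // ler_nat ltnS leq_pmull.
  - exact: sum_w_le.
by rewrite le_eqVlt; apply/orP; left; apply/eqP; ring.
Qed.

Lemma density_ratio_le n : 0 <= density_ratio e S o v n
  <= 8 * ((2 * n).+1%:R ^+ 5 * (r%:R / (Q%:R - 1)) ^+ n).
Proof.
have m0 : 0 < (Q%:R - 1) ^+ n :> R by rewrite exprn_gt0 // subr_gt0 ltr1n.
have mB : (Q%:R - 1) ^+ n <= (card_set (tree_ball e o n))%:R :> R.
  by rewrite -(natrB R (ltnW Q2)) -natrX ler_nat card_ball_ge.
rewrite /density_ratio; apply/andP; split.
  apply: divr_ge0 => [|//]; apply: mulr_ge0 => [|//]; exact: sqr_ge0.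
rewrite ler_pdivrMr; last exact: lt_le_trans mB.
(* The factor [n.+1] from the size of [S] in the ball is enlarged to [(2 * n).+1], which gives the
   constant 8 and the exponent 5. *)
apply: (@le_trans _ _ (4 * (2 * n).+1%:R ^+ 4 * (2 * (2 * n).+1%:R * r%:R ^+ n))).
  apply: ler_pM; rewrite ?sqr_ge0 ?restricted_norm_le //.
  apply: le_trans (card_setI_ball_le n) _.
  by rewrite ler_wpM2r ?exprn_ge0 // ler_wpM2l // ler_nat ltnS leq_pmull.
apply: (@le_trans _ _ (8 * ((2 * n).+1%:R ^+ 5 * (r%:R / (Q%:R - 1)) ^+ n) * (Q%:R - 1) ^+ n)).
  rewrite expr_div_n -!mulrA mulVf ?gt_eqF // mulr1.
  by rewrite le_eqVlt; apply/orP; left; apply/eqP; ring.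
by rewrite ler_wpM2l // mulr_ge0 // mulr_ge0 ?exprn_ge0 // divr_ge0 // subr_ge0 ler1n ltnW.
Qed.

End DensityBound.

(** * Geometric decay beats polynomial growth *)

Lemma linear_geometric_bounded (R : realType) (u : R) : 0 < u -> u < 1 ->
  exists2 C : R, 0 <= C & forall n, (2 * n).+1%:R * u ^+ n <= C.
Proof.
move=> u0 u1; pose h := u^-1 - 1.
have h0 : 0 < h by rewrite subr_gt0 invf_gt1.
(* Chosen so that its product with the Bernoulli bound [1 + n%:R * h] for [u^-1 ^+ n] expands to
   [2 * n%:R + 1] plus nonnegative terms. *)
exists (2 / h + 1); first by rewrite addr_ge0 // divr_ge0 // ltW.
move=> n; have bern : 1 + n%:R * h <= u^-1 ^+ n.
  have -> : u^-1 = 1 + h by rewrite addrC subrK.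
  elim: n => [|n IH]; first by rewrite mul0r addr0.
  rewrite exprSr; have nh : 0 <= n%:R * h :> R by rewrite mulr_ge0 // ltW.
  rewrite -natr1; have := ler_wpM2r (ltW (addr_gt0 ltr01 h0)) IH.
  by apply: le_trans; nra.
rewrite -ler_pdivlMr ?exprn_gt0 // -exprVn.
apply: (@le_trans _ _ ((2 / h + 1) * (1 + n%:R * h))); last first.
  by rewrite ler_wpM2l // addr_ge0 // divr_ge0 // ltW.
have -> : (2 / h + 1) * (1 + n%:R * h) = (2 / h + n%:R * h) + (2 * n%:R + 1).
  by field; rewrite gt_eqF.
rewrite -natr1 natrM lerDr addr_ge0 ?divr_ge0 ?mulr_ge0 //; exact: ltW.
Qed.

(** With [u] the root of [t] of order [k.+1], the term is the [k]-th power of the bounded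
    [(2 * n).+1%:R * u ^+ n], times [u ^+ n], which tends to 0. *)
Lemma polynomial_geometric_cvg0 (R : realType) (t : R) (k : nat) : 0 < t -> t < 1 ->
  (2 * n).+1%:R ^+ k * t ^+ n @[n --> \oo] --> (0 : R).
Proof.
move=> t0 t1; pose u := t `^ k.+1%:R^-1.
have ut : u ^+ k.+1 = t.
  by rewrite -powR_mulrn ?powR_ge0 // -powRrM mulVf ?pnatr_eq0 // powRr1 // ltW.
have u0 : 0 < u by exact: powR_gt0.
have u1 : u < 1 by rewrite -(@expr_lt1 _ k.+1) ?ut // ltW.
have [C C0 uC] := linear_geometric_bounded u0 u1.
apply: (@squeeze_cvgr _ _ _ _ (fun=> 0) (fun n => C ^+ k * u ^+ n)).
- apply: nearW => n; rewrite mulr_ge0 ?exprn_ge0 ?(ltW t0) //=.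
  have -> : t ^+ n = (u ^+ n) ^+ k * u ^+ n by rewrite -exprSr -ut -!exprM mulnC.
  rewrite mulrA -exprMn ler_wpM2r ?exprn_ge0 ?(ltW u0) //.
  by rewrite lerXn2r ?nnegrE // mulr_ge0 // exprn_ge0 // ltW.
- exact: cvg_cst.
- rewrite -[X in _ --> X](mulr0 (C ^+ k)); apply: cvgMl_tmp; apply: cvg_expr.
  by rewrite ger0_norm // ltW.
Qed.

Lemma density_ratio_cvg0 (R : realType) (V : choiceType) (e : rel V) (Q r : nat)
    (S : set V) (o : V) (w : V -> R) :
  homogeneous_tree e Q -> S o -> (0 < r)%N -> (r < Q - 1)%N ->
  (forall (s : seq V) k, uniq s -> {in s, forall x, S x} ->
    (count (fun x => dist e x o == k) s <= 2 * r ^ k)%N) ->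
  (forall y, S y -> w y ^+ 2 * r%:R ^+ dist e y o <= (dist e y o).+1%:R ^+ 2) ->
  density_ratio e S o (pf_vector e Q S o w) n @[n --> \oo] --> (0 : R).
Proof.
move=> hV So r0 rQ S_growth w_decay.
have Q2 : (2 <= Q)%N by lia.
apply: (@squeeze_cvgr _ _ _ _ (fun=> 0)
  (fun n => 8 * ((2 * n).+1%:R ^+ 5 * (r%:R / (Q%:R - 1)) ^+ n))).
- by apply: nearW => n; exact: density_ratio_le.
- exact: cvg_cst.
- rewrite -[X in _ --> X](mulr0 8); apply: cvgMl_tmp.
  have Q0 : 0 < Q%:R - 1 :> R by rewrite subr_gt0 ltr1n.
  apply: polynomial_geometric_cvg0; first by rewrite divr_gt0 // ltr0n.
  by rewrite ltr_pdivrMr // mul1r -(natrB R (ltnW Q2)) ltr_nat.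
Qed.

(** * Growth and decay on the two kinds of subtree *)

Lemma count_sphere_iso (W V : choiceType) (eW : rel W) (e : rel V) (f : W -> V)
    (S : set V) (w0 : W) (q : nat) :
  homogeneous_tree eW q -> iso_onto eW e f S ->
  (forall x, dist e (f x) (f w0) = dist eW x w0) ->
  forall (s : seq V) k, uniq s -> {in s, forall x, S x} ->
  (count (fun x => dist e x (f w0) == k) s
    <= #|` fset_set (sphere eW w0 k)|)%N.
Proof.
move=> hW [finj fS _] fd s k us sS.
rewrite -size_filter -(size_map f); apply: uniq_leq_size; first exact: filter_uniq.
move=> x; rewrite mem_filter => /andP[+ /sS].
rewrite -fS => + [y _ yx]; rewrite -yx fd => yk.
by apply: map_f; rewrite (mem_sphere hW).
Qed.

Theorem proposition2p3 (R : realType) (V : choiceType) (e : rel V) (Q : nat)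
    (hV : homogeneous_tree e Q) (S : set V) (o : V) :
  (* Y = G^{Q,q} *)
  (forall (q : nat) (W : choiceType) (eW : rel W) (f : W -> V),
     (2 <= q)%N -> (q < Q)%N -> (Q <= Qmax R q)%N ->
     homogeneous_tree eW q -> iso_onto eW e f S -> S o ->
     density_ratio e S o (pf_vector e Q S o (w_G R e o q)) n @[n --> \oo]
       --> (0 : R))
  /\
  (* Y = H^Q *)
  (forall f : nat -> V,
     (3 <= Q)%N -> (Q <= 7)%N ->
     iso_onto half_line e f S -> f 0%N = o ->
     density_ratio e S o (pf_vector e Q S o (w_H R e Q S o)) n @[n --> \oo]
       --> (0 : R)).
Proof.
have [esym eirr econ eac _] := hV; split.
  move=> q W eW f q2 qQ _ hW iso So.
  have [_ _ Wcon _ _] := hW; have [_ fS _] := iso.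
  (* The root is an arbitrary vertex of [S]; its preimage serves as root of [W], and [f] preserves
     distances to it. *)
  have [w0 _ fw0] : range f o by rewrite fS.
  rewrite -fw0 in So *.
  have fd x : dist e (f x) (f w0) = dist eW x w0.
    apply: (dist_iso_onto esym eirr econ eac (lev := fun x => dist eW x w0) iso).
    - by move=> y; exact: dist_eq0.
    - exact: distxx.
    - by move=> y k; exact: dist_parent.
  apply: (@density_ratio_cvg0 _ _ _ _ (q - 1)) => //; [lia|lia| |].
    move=> s k us sS; apply: leq_trans (card_sphere_le hW w0 k q2).
    exact: (count_sphere_iso hW iso fd).
  move=> y _; rewrite /w_G; set k := dist _ _ _.
  have q0 : 0 < q%:R - 1 :> R by rewrite subr_gt0 ltr1n.
  (* The squared power of [q%:R - 1] cancels the growth factor. What remains is the square of an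
     affine function of [k] with slope [(q%:R - 2) / q%:R] between 0 and 1. *)
  rewrite natrB ?(ltnW q2) // exprMn -[(_ `^ _) ^+ 2]powR_mulrn ?powR_ge0 // -powRrM.
  rewrite mulNr divfK // powRN powR_mulrn ?(ltW q0) // divfK ?expf_neq0 ?gt_eqF //.
  rewrite -[k.+1%:R]natr1 [1 + _]addrC.
  have c0 : 0 <= (q%:R - 2) / q%:R :> R by rewrite divr_ge0 // subr_ge0 ler_nat.
  have c1 : (q%:R - 2) / q%:R <= 1 :> R.
    by rewrite ler_pdivrMr ?ltr0n ?mul1r ?gerBl // (ltnW q2).
  rewrite lerXn2r ?nnegrE ?addr_ge0 ?(mulr_ge0 c0) // lerD2r.
  by rewrite -[leRHS]mul1r ler_wpM2r.
move=> f Q3 _ iso fo; have [_ fS _] := iso.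
have fd k : dist e (f k) o = k.
  rewrite -fo; apply: (dist_iso_onto esym eirr econ eac (lev := id) iso) => //.
  by move=> x k' ->; exists k' => //; apply/orP; right; apply/eqP.
have So : S o by rewrite -fS -fo; exists 0%N.
have Q2 : (2 <= Q)%N by lia.
(* Here [r = 1], since [f k] is the only point of [S] at distance [k]; [1 < Q - 1] comes from
   [3 <= Q]. *)
apply: (@density_ratio_cvg0 _ _ _ _ 1) => //; first lia.
  move=> s k us sS; apply: (@leq_trans 1); last by rewrite exp1n.
  rewrite -size_filter; apply: (@uniq_leq_size _ _ [:: f k]); first exact: filter_uniq.
  move=> x; rewrite mem_filter => /andP[+ /sS].
  by rewrite -fS => + [j _ jx]; rewrite -jx fd => /eqP ->; rewrite inE.
move=> y _; rewrite expr1n mulr1 /w_H; set k := dist _ _ _.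
have [a0 aQ] := a_fun_bounds Q2 (normAY_ge0 R e S).
set a := a_fun _ _ in a0 aQ *.
have Q1 : 1 <= Q%:R - 1 :> R by rewrite lerBrDr -[1 + 1]/(2%:R) ler_nat.
(* From [a ^+ 2 * (Q%:R - 1) <= 1] and [Q1]; hence the slope [1 - a] of [w_H] lies between 0 and
   1. *)
have a1 : a <= 1 by nra.
rewrite -natr1 lerXn2r ?nnegrE ?addr_ge0 ?mulr_ge0 ?subr_ge0 //.
by rewrite lerD2r -[leRHS]mul1r ler_wpM2r // gerBl.
Qed.
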